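(* Let $F$ be a field of characteristic not two and let $E$ be a finite-dimensional vector space over $F$ with an arbitrary symmetric bilinear form $(U,V)\mapsto U\cdot V$. Suppose the non-null projective points $u,v,w,z$ of $E$ are coplanar and form projective spreads $$S(uv,uz)=S(vu,vw)=S(wv,wz)=1$$ and projective quadrances $q(u,v)=q$ and $q(v,w)=p$. Assume that all the projective spreads appearing below are defined and that $qp\neq 1$. Then, with $y,x,s,r$ denoting the following projective quadrances, $$q(w,z)=y=\frac{q(1-p)}{1-qp},\qquad q(u,z)=x=\frac{p(1-q)}{1-qp},$$ $$q(u,w)=s=q+p-qp,\qquad q(v,z)=r=\frac{q+p-2qp}{1-qp},$$ and $$S(vu,vz)=\frac{x}{r},\qquad S(vw,vz)=\frac{y}{r},\qquad S(wv,wu)=\frac{q}{s},$$ $$S(uw,uv)=\frac{p}{s},\qquad S(uw,uz)=\frac{q(1-p)}{s},\qquad S(wu,wz)=\frac{p(1-q)}{s},$$ and $$S(zu,zw)=1-pq.$$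
   Context: A projective point $u=[U]$ is a one-dimensional subspace of $E$, spanned by a non-zero vector $U$; it is null if $U\cdot U=0$, and non-null otherwise. For distinct projective points $u,v$, $uv$ denotes the projective line (two-dimensional subspace) they span. Projective points are coplanar when they are all contained in a single three-dimensional subspace of $E$ (a projective plane). The projective quadrance between non-null projective points $u=[U]$, $v=[V]$ is $$q(u,v)=1-\frac{(U\cdot V)^2}{(U\cdot U)(V\cdot V)}.$$ The projective spread between the projective lines $wu$ and $wv$, where $u=[U]$, $v=[V]$, $w=[W]$ with $w$ non-null, is, putting $U'=U-\frac{U\cdot W}{W\cdot W}W$ and $V'=V-\frac{V\cdot W}{W\cdot W}W$, $$S(wu,wv)=1-\frac{(U'\cdot V')^2}{(U'\cdot U')(V'\cdot V')},$$ and it is undefined if one of the denominators is zero. Equivalently, with $a_X=X\cdot X$ and $b_{XY}=X\cdot Y$, $$S(wu,wv)=1-\frac{(a_Wb_{UV}-b_{UW}b_{VW})^2}{(a_Ua_W-b_{UW}^2)(a_Va_W-b_{VW}^2)}.$$ The bilinear form is not assumed non-degenerate. *)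

(* Defs.v *)
From HB Require Import structures.
From mathcomp Require Import all_boot all_order all_algebra.
From mathcomp Require Import sesquilinear ring.

Set Implicit Arguments.
Unset Strict Implicit.
Unset Printing Implicit Defensive.

Import GRing.Theory.
Local Open Scope ring_scope.

Record ppoint (F : fieldType) (E : vectType F) := PPoint {
  pline :> {vspace E};
  pline_dim : \dim pline = 1%N
}.

Section ProjectiveTrigonometry.
Variables (F : fieldType) (E : vectType F) (B : {symmetric E}).
Implicit Types (U V W : E) (u v w : ppoint E).

(* An arbitrary spanning vector; the lemmas nonnullE, quadranceE and spreadE
   show that the notions below do not depend on this choice. *)
Definition rep u : E := vpick u.

Definition nonnull u : bool := B (rep u) (rep u) != 0.

Definition coplanar (s : seq (ppoint E)) : Prop :=
  exists P : {vspace E},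
    \dim P = 3%N /\ all (fun u : ppoint E => (u <= P)%VS) s.

Definition vquadrance U V : F := 1 - B U V ^+ 2 / (B U U * B V V).

(* Meaningful when u and v are non-null (otherwise the denominator is zero). *)
Definition quadrance u v : F := vquadrance (rep u) (rep v).

Definition reject W U : E := U - (B U W / B W W) *: W.

Definition vspread W U V : option F :=
  let U' := reject W U in
  let V' := reject W V in
  if (B W W != 0) && (B U' U' * B V' V' != 0)
  then Some (1 - B U' V' ^+ 2 / (B U' U' * B V' V'))
  else None.

(* spread w u v is S(wu, wv), None meaning "undefined".  When u = w (or v = w),
   so that there is no line wu (or wv), the vector U' (or V') is zero and the
   value is None. *)
Definition spread w u v : option F := vspread (rep w) (rep u) (rep v).

Definition spread_defined w u v : bool := isSome (spread w u v).

Lemma rep_span u U : u = <[U]>%VS :> {vspace E} ->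
  exists2 k : F, k != 0 & rep u = k *: U.
Proof.
move=> uE; have := memv_pick u; rewrite {2}uE => /vlineP[k repE].
exists k => //; apply/eqP => k0; move: repE; rewrite k0 scale0r => /eqP.
by rewrite vpick0 -dimv_eq0 pline_dim.
Qed.

Lemma formZ (a b : F) U V : B (a *: U) (b *: V) = a * b * B U V.
Proof. by rewrite linearZl_LR linearZr /= mulrA. Qed.

Lemma nonnullE u U : u = <[U]>%VS :> {vspace E} -> nonnull u = (B U U != 0).
Proof.
move=> /rep_span[k k0 repE].
by rewrite /nonnull repE formZ !mulf_eq0 !negb_or k0.
Qed.

Lemma ratioZ (a b : F) U V : a != 0 -> b != 0 ->
  B (a *: U) (b *: V) ^+ 2 / (B (a *: U) (a *: U) * B (b *: V) (b *: V)) =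
  B U V ^+ 2 / (B U U * B V V).
Proof.
move=> a0 b0; rewrite !formZ exprMn.
have -> : a * a * B U U * (b * b * B V V) =
  (a * b) ^+ 2 * (B U U * B V V) by ring.
by rewrite -mulf_div divff ?mul1r // expf_neq0 // mulf_neq0.
Qed.

Lemma quadranceE u v U V :
  u = <[U]>%VS :> {vspace E} -> v = <[V]>%VS :> {vspace E} ->
  quadrance u v = 1 - B U V ^+ 2 / (B U U * B V V).
Proof.
move=> /rep_span[a a0 uE] /rep_span[b b0 vE].
by rewrite /quadrance /vquadrance uE vE ratioZ.
Qed.

Lemma rejectZ (a c : F) W U : c != 0 ->
  reject (c *: W) (a *: U) = a *: reject W U.
Proof.
move=> c0; rewrite /reject !formZ scalerBr !scalerA; congr (_ - _ *: _).
have [->|W0] := eqVneq (B W W) 0; first by rewrite !(mulr0, invr0, mul0r).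
by field; apply/andP; split; [exact: W0 | exact: c0].
Qed.

Lemma spreadE w u v W U V : w = <[W]>%VS :> {vspace E} ->
  u = <[U]>%VS :> {vspace E} -> v = <[V]>%VS :> {vspace E} ->
  spread w u v = vspread W U V.
Proof.
move=> /rep_span[c c0 wE] /rep_span[a a0 uE] /rep_span[b b0 vE].
rewrite /spread /vspread wE uE vE !rejectZ // ratioZ //.
by rewrite !formZ !mulf_eq0 (negPf a0) (negPf b0) (negPf c0).
Qed.

End ProjectiveTrigonometry.

(* Main.v *)
Require Import Defs.
From mathcomp Require Import all_boot all_order all_algebra.
From mathcomp Require Import sesquilinear.
From mathcomp Require Import ring.

Set Implicit Arguments.
Unset Strict Implicit.
Unset Printing Implicit Defensive.

Import GRing.Theory.
Local Open Scope ring_scope.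

(** Choose spanning vectors [U, V, W, Z] of the points.  Since
    [S(vu, vw) = 1], the rejections [e1], [e3] of [U], [W] from [e2 = V] are
    orthogonal to each other as well as to [V], so [e1, e2, e3] is an orthogonal
    triple of non-null vectors; such a triple is free ([orthogonal_free]), hence
    a basis of the plane of the quadrilateral, even when the form on the whole
    space is degenerate ([right_spread_frame]).

    In this basis [U = (1, a, 0)], [V = (0, 1, 0)] and [W = (0, c, 1)], and the
    right spreads at [u] and [w] are two linear equations in the coordinates of
    [Z], which make [Z] proportional to [(c, a * c, a)] unless [a] and [c] both
    vanish; in that case [q = p = 1], against [q * p != 1]
    ([trirectangle_fourth]).

    All the quadrances and spreads are thereby explicit rational functions of
    [a], [c] and the three values [B e1 e1], [B e2 e2], [B e3 e3]
    ([vquadranceE], [vspreadE], [combE]), and each formula of the theorem is an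
    identity between such functions ([trirectangle_formulas]).  Their
    denominators are products of values of the form at the four vectors and of
    Gram determinants of pairs of them; the former are non-zero because the
    points are non-null, the latter because the spreads are defined. *)

(** * Points, rejections and Gram determinants *)

Lemma symE (F : fieldType) (E : vectType F) (B : {symmetric E}) (x y : E) :
  B x y = B y x.
Proof. by rewrite hermC expr0 mul1r. Qed.

Lemma point_rep (F : fieldType) (E : vectType F) (u : ppoint E) :
  u = <[rep u]>%VS :> {vspace E}.
Proof.
apply/eqP; rewrite eq_sym eqEdim -memvE memv_pick dim_vline pline_dim.
by rewrite /rep vpick0 -dimv_eq0 pline_dim.
Qed.

(** The line [u] is contained in [<[X]>], whose dimension is at most one. *)
Lemma point_span (F : fieldType) (E : vectType F) (u : ppoint E) (k : F)
    (X : E) : rep u = k *: X -> u = <[X]>%VS :> {vspace E}.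
Proof.
move=> uE; apply/eqP; rewrite eqEdim dim_vline pline_dim leq_b1 andbT.
by rewrite point_rep uE -memvE memvZ ?memv_line.
Qed.

Lemma reject_formE (F : fieldType) (E : vectType F) (B : {symmetric E})
    (W X Y : E) : B W W != 0 ->
  B (reject B W X) (reject B W Y) = B X Y - B X W * B Y W / B W W.
Proof.
move=> W0; rewrite /reject linearBl !linearBr /= !linearZl_LR !linearZr /=.
by rewrite (symE B W Y); field.
Qed.

Lemma reject_orth (F : fieldType) (E : vectType F) (B : {symmetric E})
    (W X : E) : B W W != 0 -> B (reject B W X) W = 0.
Proof. by move=> W0; rewrite /reject linearBl linearZl_LR /= divfK ?subrr. Qed.

Definition gram2 (F : fieldType) (E : vectType F) (B : {symmetric E})
  (X Y : E) : F := B X X * B Y Y - B X Y ^+ 2.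

Lemma gram2C (F : fieldType) (E : vectType F) (B : {symmetric E}) (X Y : E) :
  gram2 B X Y = gram2 B Y X.
Proof. by rewrite /gram2 mulrC (symE B X Y). Qed.

Lemma gram2_reject (F : fieldType) (E : vectType F) (B : {symmetric E})
    (W X : E) : B W W != 0 ->
  gram2 B W X = B W W * B (reject B W X) (reject B W X).
Proof. by move=> W0; rewrite gram2C /gram2 reject_formE //; field. Qed.

Lemma vquadranceE (F : fieldType) (E : vectType F) (B : {symmetric E})
    (X Y : E) : B X X != 0 -> B Y Y != 0 ->
  vquadrance B X Y = gram2 B X Y / (B X X * B Y Y).
Proof. by move=> X0 Y0; rewrite /vquadrance /gram2; field; rewrite X0 Y0. Qed.

(** Clearing the denominators introduced by the rejections expresses the spread
    through the form at the three original vectors; its denominator is the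
    product of the Gram determinants of the two lines, so that a defined spread
    makes both of them non-zero. *)
Lemma vspreadE (F : fieldType) (E : vectType F) (B : {symmetric E})
    (W X Y : E) : isSome (vspread B W X Y) ->
  [/\ B W W != 0, gram2 B W X != 0, gram2 B W Y != 0 &
      vspread B W X Y =
      Some (1 - (B W W * B X Y - B W X * B W Y) ^+ 2 /
        (gram2 B W X * gram2 B W Y))].
Proof.
rewrite /vspread; case: ifP => // /andP[W0 D0] _.
move: (D0); rewrite mulf_eq0 negb_or => /andP[X0 Y0].
rewrite !gram2_reject // !mulf_neq0 //; split=> //; congr (Some (1 - _)).
have -> : B W W * B X Y - B W X * B W Y =
    B W W * B (reject B W X) (reject B W Y).
  by rewrite reject_formE // (symE B X W) (symE B Y W); field.
by field; rewrite X0 Y0 W0.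
Qed.

(** Both sides of the conclusion differ by [B W W] times the product of the
    rejections of [X] and [Y] from [W]: the two lines are perpendicular. *)
Lemma vspread1_orth (F : fieldType) (E : vectType F) (B : {symmetric E})
    (W X Y : E) : vspread B W X Y = Some 1 ->
  B W W * B X Y = B W X * B W Y.
Proof.
move=> S1; have [|W0 X0 Y0] := @vspreadE _ _ B W X Y; first by rewrite S1.
rewrite S1 => -[/eqP]; rewrite eq_sym subr_eq addrC -subr_eq subrr eq_sym.
rewrite mulf_eq0 invr_eq0 (negPf (mulf_neq0 X0 Y0)) orbF expf_eq0 /=.
by rewrite subr_eq0 => /eqP.
Qed.

(** * Orthogonal triples *)

(** A dependency expressing one vector through the later ones would make it
    orthogonal to itself. *)
Lemma orthogonal_free (F : fieldType) (E : vectType F) (B : {symmetric E})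
    (X : seq E) : all (fun e => B e e != 0) X ->
  pairwise (fun e f => B e f == 0) X -> free X.
Proof.
elim: X => [|e X IH]; first by rewrite nil_free.
rewrite /= free_cons => /andP[e0 X0] /andP[/allP eX pX].
rewrite IH // andbT; apply: contraNN e0 => /(@coord_span _ _ _ (in_tuple X)) eE.
rewrite {2}eE linear_sumr big1 //= => i _.
by rewrite linearZr /= (eqP (eX _ _)) ?mulr0 ?mem_nth.
Qed.

Definition comb (F : fieldType) (E : vectType F) (e1 e2 e3 : E)
  (x1 x2 x3 : F) : E := x1 *: e1 + x2 *: e2 + x3 *: e3.

Definition orthogonal_triple (F : fieldType) (E : vectType F)
  (B : {symmetric E}) (e1 e2 e3 : E) : Prop :=
  [/\ B e1 e2 = 0, B e1 e3 = 0 & B e2 e3 = 0].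

Lemma combE (F : fieldType) (E : vectType F) (B : {symmetric E})
    (e1 e2 e3 : E) : orthogonal_triple B e1 e2 e3 ->
  forall x1 x2 x3 y1 y2 y3 : F,
  B (comb e1 e2 e3 x1 x2 x3) (comb e1 e2 e3 y1 y2 y3) =
  x1 * y1 * B e1 e1 + x2 * y2 * B e2 e2 + x3 * y3 * B e3 e3.
Proof.
case=> e12 e13 e23 x1 x2 x3 y1 y2 y3; rewrite /comb !linearDl !linearDr /=.
rewrite !Defs.formZ (symE B e2 e1) (symE B e3 e1) (symE B e3 e2) e12 e13 e23.
by ring.
Qed.

Lemma orthogonal_triple_span (F : fieldType) (E : vectType F)
    (B : {symmetric E}) (e1 e2 e3 : E) (P : {vspace E}) :
  orthogonal_triple B e1 e2 e3 ->
  B e1 e1 != 0 -> B e2 e2 != 0 -> B e3 e3 != 0 ->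
  \dim P = 3%N -> e1 \in P -> e2 \in P -> e3 \in P ->
  forall Z, Z \in P -> exists z1 z2 z3, Z = comb e1 e2 e3 z1 z2 z3.
Proof.
case=> e12 e13 e23 n1 n2 n3 dimP e1P e2P e3P Z ZP.
have bP : basis_of P [tuple e1; e2; e3].
  rewrite basisEfree dimP /= andbT; apply/andP; split.
    apply: (@orthogonal_free _ _ B); first by rewrite /= n1 n2 n3.
    by rewrite /= e12 e13 e23 !eqxx.
  by apply/span_subvP=> e; rewrite !inE => /or3P[] /eqP->.
exists (coord [tuple e1; e2; e3] ord0 Z).
exists (coord [tuple e1; e2; e3] (lift ord0 ord0) Z).
exists (coord [tuple e1; e2; e3] (lift ord0 (lift ord0 ord0)) Z).
by rewrite {1}(coord_basis bP ZP) !big_ord_recl big_ord0 addr0 /= addrA.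
Qed.

(** * The quadrilateral in coordinates *)

(** The rejections of [U] and [W] from [V] have product
    [B U W - B U V * B V W / B V V], which vanishes because the spread at [V]
    is one. *)
Lemma right_spread_frame (F : fieldType) (E : vectType F) (B : {symmetric E})
    (P : {vspace E}) (U V W : E) :
  \dim P = 3%N -> U \in P -> V \in P -> W \in P ->
  vspread B V U W = Some 1 ->
  exists e1 e2 e3 : E, exists a c : F,
    [/\ orthogonal_triple B e1 e2 e3,
        B e1 e1 != 0, B e2 e2 != 0 & B e3 e3 != 0] /\
    [/\ U = comb e1 e2 e3 1 a 0, V = comb e1 e2 e3 0 1 0,
        W = comb e1 e2 e3 0 c 1 &
        forall Z, Z \in P -> exists z1 z2 z3, Z = comb e1 e2 e3 z1 z2 z3].
Proof.
move=> dimP UP VP WP SV.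
have [|V0 UV0 WV0 _] := @vspreadE _ _ B V U W; first by rewrite SV.
move: UV0 WV0; rewrite !gram2_reject // !mulf_eq0 (negPf V0) /= => n1 n3.
have orth : orthogonal_triple B (reject B V U) V (reject B V W).
  split; first exact: reject_orth.
    rewrite reject_formE // (symE B U V) (symE B W V) -(vspread1_orth SV).
    by rewrite mulrAC mulfV // mul1r subrr.
  by rewrite symE reject_orth.
have rejP T : T \in P -> reject B V T \in P by move=> TP; rewrite memvB ?memvZ.
exists (reject B V U), V, (reject B V W), (B U V / B V V), (B W V / B V V).
split=> //; split; rewrite /comb ?scale1r ?scale0r ?addr0 ?add0r //.
- by rewrite subrK.
- by rewrite addrC subrK.
- by apply: orthogonal_triple_span orth _ _ _ dimP _ _ _; rewrite ?rejP.
Qed.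

(** The right spreads at [U] and [W] amount to [z2 = a * z1] and
    [z2 = c * z3].  When [a] or [c] is non-zero, the solutions of these two
    equations form the line spanned by [(c, a * c, a)]; when both vanish, the
    two quadrances are equal to one. *)
Lemma trirectangle_fourth (F : fieldType) (E : vectType F) (B : {symmetric E})
    (e1 e2 e3 : E) (a c z1 z2 z3 : F) :
  let U := comb e1 e2 e3 1 a 0 in let V := comb e1 e2 e3 0 1 0 in
  let W := comb e1 e2 e3 0 c 1 in let Z := comb e1 e2 e3 z1 z2 z3 in
  orthogonal_triple B e1 e2 e3 ->
  B e1 e1 != 0 -> B e2 e2 != 0 -> B e3 e3 != 0 ->
  vspread B U V Z = Some 1 -> vspread B W V Z = Some 1 ->
  vquadrance B U V * vquadrance B V W != 1 ->
  exists k, Z = k *: comb e1 e2 e3 c (a * c) a.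
Proof.
move=> U V W Z orth n1 n2 n3 SU SW qp.
have scaleE k x1 x2 x3 : k *: comb e1 e2 e3 x1 x2 x3 =
    comb e1 e2 e3 (k * x1) (k * x2) (k * x3).
  by rewrite /comb !scalerDr !scalerA.
have z2a : z2 = a * z1.
  apply: (mulfI (mulf_neq0 n1 n2)); have := vspread1_orth SU.
  rewrite !combE // => /eqP; rewrite -subr_eq0 => /eqP UE.
  by apply/eqP; rewrite -subr_eq0 -UE; apply/eqP; ring.
have z2c : z2 = c * z3.
  apply: (mulfI (mulf_neq0 n3 n2)); have := vspread1_orth SW.
  rewrite !combE // => /eqP; rewrite -subr_eq0 => /eqP WE.
  by apply/eqP; rewrite -subr_eq0 -WE; apply/eqP; ring.
have [c0 | c0] := eqVneq c 0; last first.
  exists (z1 / c); rewrite /Z z2a scaleE; congr comb; try by field.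
  by apply: (mulfI c0); rewrite -z2c z2a; field.
have [a0 | a0] := eqVneq a 0; last first.
  exists (z3 / a); rewrite /Z z2c scaleE; congr comb; try by field.
  by apply: (mulfI a0); rewrite -z2a z2c; field.
case/eqP: qp; rewrite /vquadrance !combE // a0 c0.
by field; rewrite ?n1 ?n2 ?n3.
Qed.

(** The Gram determinants of the lines [uz] and [wz] contain the factors
    [B U U] and [B W W], so that the quadrances [x] and [y] simplify.  Writing
    [XX] for [B X X] and [mi] for [B ei ei], one gets [q = m1 / UU],
    [p = m3 / WW], [x = a ^+ 2 * m3 / ZZ], [y = c ^+ 2 * m1 / ZZ] and
    [1 - q * p = m2 * ZZ / (UU * WW)]; the last expression is non-zero, so that
    the divisions by [1 - q * p] are legitimate. *)
Lemma trirectangle_formulas (F : fieldType) (E : vectType F)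
    (B : {symmetric E}) (e1 e2 e3 : E) (a c : F) :
  let U := comb e1 e2 e3 1 a 0 in let V := comb e1 e2 e3 0 1 0 in
  let W := comb e1 e2 e3 0 c 1 in let Z := comb e1 e2 e3 c (a * c) a in
  let q := vquadrance B U V in let p := vquadrance B V W in
  let y := vquadrance B W Z in let x := vquadrance B U Z in
  let s := vquadrance B U W in let r := vquadrance B V Z in
  orthogonal_triple B e1 e2 e3 ->
  B U U != 0 -> B V V != 0 -> B W W != 0 -> B Z Z != 0 ->
  isSome (vspread B V U Z) -> isSome (vspread B V W Z) ->
  isSome (vspread B W V U) -> isSome (vspread B U W V) ->
  isSome (vspread B U W Z) -> isSome (vspread B W U Z) ->
  isSome (vspread B Z U W) ->
  [/\ y = q * (1 - p) / (1 - q * p),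
      x = p * (1 - q) / (1 - q * p),
      s = q + p - q * p &
      r = (q + p - 2%:R * q * p) / (1 - q * p)] /\
  [/\ vspread B V U Z = Some (x / r),
      vspread B V W Z = Some (y / r) &
      vspread B W V U = Some (q / s)] /\
  [/\ vspread B U W V = Some (p / s),
      vspread B U W Z = Some (q * (1 - p) / s) &
      vspread B W U Z = Some (p * (1 - q) / s)] /\
  vspread B Z U W = Some (1 - p * q).
Proof.
move=> U V W Z q p y x s r orth U0 V0 W0 Z0.
move=> /vspreadE[_ UV0 VZ0 ->] /vspreadE[_ VW0 _ ->] /vspreadE[_ _ UW0 ->].
move=> /vspreadE[_ _ _ ->] /vspreadE[_ _ UZ0 ->] /vspreadE[_ _ WZ0 ->].
move=> /vspreadE[_ _ _ ->].
rewrite /q /p /y /x /s /r !vquadranceE // {q p y x s r}.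
move: UV0 VZ0 VW0 UW0 UZ0 WZ0.
rewrite (gram2C B V U) (gram2C B W U) (gram2C B W V).
rewrite (gram2C B Z U) (gram2C B Z W) (symE B V U) (symE B W U).
rewrite (symE B W V) (symE B Z U) (symE B Z W).
pose m1 := B e1 e1; pose m2 := B e2 e2; pose m3 := B e3 e3.
have UU : B U U = m1 + a ^+ 2 * m2 by rewrite combE // -/m1 -/m2 -/m3; ring.
have VV : B V V = m2 by rewrite combE // -/m1 -/m2 -/m3; ring.
have WW : B W W = c ^+ 2 * m2 + m3 by rewrite combE // -/m1 -/m2 -/m3; ring.
have ZZ : B Z Z = c ^+ 2 * m1 + (a * c) ^+ 2 * m2 + a ^+ 2 * m3.
  by rewrite combE // -/m1 -/m2 -/m3; ring.
have UV : B U V = a * m2 by rewrite combE // -/m1 -/m2 -/m3; ring.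
have VW : B V W = c * m2 by rewrite combE // -/m1 -/m2 -/m3; ring.
have UW : B U W = a * c * m2 by rewrite combE // -/m1 -/m2 -/m3; ring.
have UZ : B U Z = c * (m1 + a ^+ 2 * m2).
  by rewrite combE // -/m1 -/m2 -/m3; ring.
have WZ : B W Z = a * (c ^+ 2 * m2 + m3).
  by rewrite combE // -/m1 -/m2 -/m3; ring.
have VZ : B V Z = a * c * m2 by rewrite combE // -/m1 -/m2 -/m3; ring.
have gUV : gram2 B U V = m1 * m2 by rewrite /gram2 UU VV UV; ring.
have gVW : gram2 B V W = m2 * m3 by rewrite /gram2 VV WW VW; ring.
have gUW : gram2 B U W = m1 * m3 + (c ^+ 2 * m1 + a ^+ 2 * m3) * m2.
  by rewrite /gram2 UU WW UW; ring.
have gVZ : gram2 B V Z = m2 * (c ^+ 2 * m1 + a ^+ 2 * m3).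
  by rewrite /gram2 VV ZZ VZ; ring.
have gUZ : gram2 B U Z = a ^+ 2 * m3 * (m1 + a ^+ 2 * m2).
  by rewrite /gram2 UU ZZ UZ; ring.
have gWZ : gram2 B W Z = c ^+ 2 * m1 * (c ^+ 2 * m2 + m3).
  by rewrite /gram2 WW ZZ WZ; ring.
move: U0 V0 W0 Z0.
rewrite gUV gVW gUW gVZ gUZ gWZ UU VV WW ZZ UV VW UW UZ WZ VZ.
move: m1 m2 m3 {UU VV WW ZZ UV VW UW UZ WZ VZ gUV gVW gUW gVZ gUZ gWZ}.
move=> m1 m2 m3 U0 m20 W0 Z0.
rewrite !mulf_eq0 !negb_or (negPf m20) -!andbA /=.
move=> /andP[m10 _] R0 m30 S0 /and3P[a0 _ _] /and3P[c0 _ _].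
have nz := (m10, m20, m30, a0, c0, U0, W0, Z0, R0, S0).
have -> : 1 - m1 * m2 / ((m1 + a ^+ 2 * m2) * m2) *
      (m2 * m3 / (m2 * (c ^+ 2 * m2 + m3))) =
    m2 * (c ^+ 2 * m1 + (a * c) ^+ 2 * m2 + a ^+ 2 * m3) /
      ((m1 + a ^+ 2 * m2) * (c ^+ 2 * m2 + m3)).
  by field; rewrite !nz.
by do !split; try congr Some; field; rewrite !nz.
Qed.

(** * The theorem *)

Theorem theorem19 (F : fieldType) (hF : 2%N \notin [pchar F])
    (E : vectType F) (B : {symmetric E})
    (u v w z : ppoint E)
    (hu : nonnull B u) (hv : nonnull B v) (hw : nonnull B w) (hz : nonnull B z)
    (hcop : coplanar [:: u; v; w; z])
    (hSu : spread B u v z = Some 1)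
    (hSv : spread B v u w = Some 1)
    (hSw : spread B w v z = Some 1)
    (q p y x s r : F)
    (hq : quadrance B u v = q) (hp : quadrance B v w = p)
    (hdef1 : spread_defined B v u z) (hdef2 : spread_defined B v w z)
    (hdef3 : spread_defined B w v u) (hdef4 : spread_defined B u w v)
    (hdef5 : spread_defined B u w z) (hdef6 : spread_defined B w u z)
    (hdef7 : spread_defined B z u w)
    (hqp : q * p != 1)
    (hy : quadrance B w z = y) (hx : quadrance B u z = x)
    (hs : quadrance B u w = s) (hr : quadrance B v z = r) :
  [/\ y = q * (1 - p) / (1 - q * p),
      x = p * (1 - q) / (1 - q * p),
      s = q + p - q * p &
      r = (q + p - 2%:R * q * p) / (1 - q * p)] /\
  [/\ spread B v u z = Some (x / r),
      spread B v w z = Some (y / r) &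
      spread B w v u = Some (q / s)] /\
  [/\ spread B u w v = Some (p / s),
      spread B u w z = Some (q * (1 - p) / s) &
      spread B w u z = Some (p * (1 - q) / s)] /\
  spread B z u w = Some (1 - p * q).
Proof.
case: hcop => P [dimP /=]; rewrite andbT => /and4P[uP vP wP zP].
have repP (t : ppoint E) : (t <= P)%VS -> rep t \in P.
  by move/subvP; apply; apply: memv_pick.
have [e1 [e2 [e3 [a [c [[orth n1 n2 n3] [UE VE WE spanP]]]]]]] :=
  right_spread_frame dimP (repP _ uP) (repP _ vP) (repP _ wP) hSv.
have [z1 [z2 [z3 ZE]]] := spanP _ (repP _ zP).
have [k kE] : exists k, rep z = k *: comb e1 e2 e3 c (a * c) a.
  rewrite ZE; apply: trirectangle_fourth orth n1 n2 n3 _ _ _.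
  - by rewrite -UE -VE -ZE.
  - by rewrite -WE -VE -ZE.
  - by rewrite -UE -VE -WE -hq -hp in hqp *.
have zline := point_span kE.
have uline := point_rep u; rewrite UE in uline.
have vline := point_rep v; rewrite VE in vline.
have wline := point_rep w; rewrite WE in wline.
move: hu hv hw hz hdef1 hdef2 hdef3 hdef4 hdef5 hdef6 hdef7.
rewrite -hy -hx -hs -hr -hq -hp /spread_defined.
rewrite !(quadranceE B uline vline, quadranceE B vline wline).
rewrite !(quadranceE B wline zline, quadranceE B uline zline).
rewrite !(quadranceE B uline wline, quadranceE B vline zline).
rewrite (nonnullE B uline) (nonnullE B vline) (nonnullE B wline).
rewrite (nonnullE B zline).
rewrite (spreadE B vline uline zline) (spreadE B vline wline zline).
rewrite (spreadE B wline vline uline) (spreadE B uline wline vline).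
rewrite (spreadE B uline wline zline) (spreadE B wline uline zline).
rewrite (spreadE B zline uline wline).
exact: trirectangle_formulas orth.
Qed.
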